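(* Let $X\subseteq\overline X$ and $Y\subseteq\overline Y$ be objects of $\mathcal S_p$ and let $\overline F\colon\overline X\to\overline Y$ be a morphism in $\mathcal S_p$. There is a noncommutative coarse map $\varphi$ from $C_0(Y)\triangleleft C(\overline Y)$ to $C_0(X)\triangleleft C(\overline X)$ so that $\partial\varphi=(\partial F)^*$. Two morphisms $\overline{F_1},\overline{F_2}\colon\overline X\to\overline Y$ in $\mathcal S_p$ are close if and only if the corresponding noncommutative coarse maps are close.
   Context: All spaces are Hausdorff. A compactification of a locally compact space $X$ is a compact space $\overline X$ with a homeomorphism from $X$ onto a dense open subset of $\overline X$; $\partial X:=\overline X\setminus X$. The category $\mathcal S$: objects are compactified spaces $X\subseteq\overline X$ with $X$ $\sigma$-compact and locally compact. A morphism from $X\subseteq\overline X$ to $Y\subseteq\overline Y$ is a map $\overline F\colon\overline X\to\overline Y$ with $\overline F(X)\subseteq Y$ and $\overline F(\partial X)\subseteq\partial Y$ that is continuous at all points of $\partial X$ (not necessarily on $X$). Put $\partial F:=\overline F|_{\partial X}\colon\partial X\to\partial Y$, and $(\partial F)^*\colon C(\partial Y)\to C(\partial X)$, $h\mapsto h\circ\partial F$. Two morphisms are close if they induce the same map $\partial X\to\partial Y$. $\mathcal S_p\subseteq\mathcal S$ is the full subcategory of those compactified spaces for which the subsets $\{(x,x)\mid x\in X\}$ and $\{(x,y)\in\overline X\times\overline X\mid x\ne y\text{ and }(x\in\partial X\text{ or }y\in\partial X)\}$ of $\overline X\times\overline X$ are contained in disjoint open subsets of $\overline X\times\overline X$.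 A noncommutative coarse space $A\triangleleft\overline A$ is a $C^*$-algebra $A$ with a unital $C^*$-algebra $\overline A$ containing $A$ as an essential ideal; $\partial A:=\overline A/A$. For a compactified space, $C_0(X)\triangleleft C(\overline X)$ is one, with $\partial C_0(X)=C(\partial X)$. A noncommutative coarse map from $A\triangleleft\overline A$ to $B\triangleleft\overline B$ is a triple of maps $\varphi\colon A\to B$, $\overline\varphi\colon\overline A\to\overline B$, $\partial\varphi\colon\partial A\to\partial B$ compatible with inclusions and quotient maps, such that $\overline\varphi$ is unital, completely positive and continuous for the strict topologies (restricted from $\mathcal M(A)$, $\mathcal M(B)$), and $\partial\varphi$ is a $^*$-homomorphism. Two such maps are close if they induce the same map on the boundaries. A noncommutative coarse map corresponding to $\overline F$ is one with $\partial\varphi=(\partial F)^*$. *)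

(* Defs.v *)
From HB Require Import structures.
From mathcomp Require Import all_boot all_order all_algebra.
From mathcomp Require Import complex.
From mathcomp Require Import all_classical all_reals all_analysis.

Set Implicit Arguments.
Unset Strict Implicit.
Unset Printing Implicit Defensive.

Import Order.TTheory GRing.Theory Num.Theory.
Import numFieldNormedType.Exports.

Local Open Scope classical_set_scope.
Local Open Scope ring_scope.
Local Open Scope complex_scope.

Local Notation Re := complex.Re.
Local Notation Im := complex.Im.

Section ComplexTopology.
Variable R : realType.
Local Notation C := R[i]^o.

Lemma posc (e : R[i]) : 0 < e -> exists2 r : R, 0 < r & e = r%:C.
Proof.
by case: e => a b; rewrite ltcE /= => /andP[/eqP-> a0]; exists a.
Qed.

Lemma normc_Re (z : R[i]) : (Re `|z|)%:C = `|z|.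
Proof. by rewrite RRe_real ?normr_real. Qed.

Lemma ReK (r : R) : Re (r%:C) = r. Proof. by []. Qed.

Lemma Re_normc_ge0 (z : R[i]) : 0 <= Re `|z|.
Proof. by rewrite -ler0c normc_Re. Qed.

Lemma Re_normc_le (z : R[i]) : `|Re z| <= Re `|z|.
Proof. by rewrite -lecR normc_Re normc_ge_Re. Qed.

Lemma Im_normc_le (z : R[i]) : `|Im z| <= Re `|z|.
Proof.
rewrite normc_def /= -sqrtr_sqr ler_sqrt ?lerDr ?sqr_ge0//.
by rewrite addr_ge0 ?sqr_ge0.
Qed.

Lemma normc_le_ReIm (z : R[i]) : Re `|z| <= `|Re z| + `|Im z|.
Proof.
rewrite normc_def /= -[leRHS]ger0_norm ?addr_ge0// -sqrtr_sqr ler_sqrt ?sqr_ge0//.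
by rewrite sqrrD !real_normK ?num_real// lerD2r lerDl mulrn_wge0 ?mulr_ge0.
Qed.

Lemma near_distc (z : C) (e : R[i]) : 0 < e ->
  \forall w \near z, `|z - w| < e.
Proof.
by move=> e0; apply: (@cvgr_dist_lt _ C _ (nbhs z) _ id z).
Qed.

Lemma continuous_Re : continuous (@Re R : C -> R).
Proof.
move=> z; apply/(@cvgrPdist_lt _ R^o _ (nbhs (z : C))) => e e0.
have : \forall w \near (z : C), `|z - w| < e%:C.
  by apply: near_distc; rewrite ltcR.
apply: filterS => w zw; rewrite -raddfB /=.
by apply: (le_lt_trans (Re_normc_le _)); rewrite -ltcR normc_Re.
Qed.

Lemma continuous_Im : continuous (@Im R : C -> R).
Proof.
move=> z; apply/(@cvgrPdist_lt _ R^o _ (nbhs (z : C))) => e e0.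
have : \forall w \near (z : C), `|z - w| < e%:C.
  by apply: near_distc; rewrite ltcR.
apply: filterS => w zw; rewrite -raddfB /=.
by apply: (le_lt_trans (Im_normc_le _)); rewrite -ltcR normc_Re.
Qed.

Lemma cvg_Complex (T : Type) (F : set_system T) (FF : Filter F)
    (f g : T -> R) (a b : R) :
  f @ F --> a -> g @ F --> b ->
  (fun x => f x +i* g x : C) @ F --> (a +i* b : C).
Proof.
move=> /(@cvgrPdist_lt _ R^o) fa /(@cvgrPdist_lt _ R^o) gb.
apply/(@cvgrPdist_lt _ C) => e /posc[r r0 ->].
have r20 : 0 < r / 2 by rewrite divr_gt0.
move: (fa _ r20) (gb _ r20); apply: filterS2 => x /= fx gx.
rewrite -normc_Re ltcR (le_lt_trans (normc_le_ReIm _))//.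
by rewrite (splitr r) ltrD.
Qed.

Lemma continuous_real_complex (T : topologicalType) (g : T -> R) :
  continuous g -> continuous (fun x => (g x)%:C : C).
Proof. by move=> cg x; apply: cvg_Complex; [exact: cg|exact: cvg_cst]. Qed.

Lemma continuous_conj : continuous (@Num.conj _ : C -> C).
Proof.
move=> z; apply/(@cvgrPdist_lt _ C _ (nbhs (z : C))) => e e0.
have := near_distc z e0.
by apply: filterS => w; rewrite -rmorphB norm_conjC.
Qed.

Lemma complex_cauchy_cvg (F : set_system C) :
  ProperFilter F -> cauchy F -> cvg F.
Proof.
move=> FF /cauchy_ballP Fc.
have cR (h : C -> R) : (forall z w, `|h z - h w| <= Re `|z - w|) ->
    exists a : R, h @ F --> a.
  move=> hL; apply/cvg_ex/cauchy_cvgP/cauchy_ballP => e e0.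
  have e0' : 0 < e%:C by rewrite ltcR.
  have [[A B] [FA FB] AB] := Fc _ e0'.
  exists (h @` A, h @` B).
    split; rewrite /= nbhs_simpl; [apply: filterS FA|apply: filterS FB].
      by move=> z Az; exists z.
    by move=> z Bz; exists z.
  move=> [_ _] [/= [z Az <-] [w Bw <-]]; rewrite -ball_normE /=.
  apply: (le_lt_trans (hL _ _)); rewrite -ltcR normc_Re.
  by have := AB (z, w) (conj Az Bw); rewrite -ball_normE.
have [a Fa] := cR (@Re R) (fun z w => eq_ind _ (fun t => `|t| <= _) (Re_normc_le (z - w)) _ (raddfB _ z w)).
have [b Fb] := cR (@Im R) (fun z w => eq_ind _ (fun t => `|t| <= _) (Im_normc_le (z - w)) _ (raddfB _ z w)).
apply/cvg_ex; exists (a +i* b).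
have := cvg_Complex FF Fa Fb; apply: cvg_trans.
rewrite (_ : (fun x => _) = id) ?map_id //; last by apply/funext => -[].
Qed.

End ComplexTopology.

HB.mixin Record isCompactHausdorff T & Topological T := {
  compact_univ : compact [set: T];
  hausdorff_univ : hausdorff_space T }.

#[short(type="compactHausdorffType")]
HB.structure Definition CompactHausdorff :=
  {T of Topological T & isCompactHausdorff T}.

(* A unital C*-algebra; the zero algebra is allowed, as it is C(T) for T empty.
   The multiplication cannot be inherited from GRing.PzRing, because HB already
   has Num.NumDomain as the join of normed groups and rings: it is a field of
   the mixin, and the ring structure is derived from it just below. *)
HB.mixin Record isCStarAlgebra (R : realType) A
    & CompleteNormedModule R[i] A := {
  cstar_mul : A -> A -> A;
  cstar_one : A;
  star : A -> A;
  cstar_mulA : associative cstar_mul;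
  cstar_mul1l : left_id cstar_one cstar_mul;
  cstar_mul1r : right_id cstar_one cstar_mul;
  cstar_mulDl : left_distributive cstar_mul +%R;
  cstar_mulDr : right_distributive cstar_mul +%R;
  cstar_mulZl : forall (c : R[i]) (a b : A),
    cstar_mul (c *: a) b = c *: cstar_mul a b;
  cstar_mulZr : forall (c : R[i]) (a b : A),
    cstar_mul a (c *: b) = c *: cstar_mul a b;
  cstar_normM : forall a b : A, `|cstar_mul a b| <= `|a| * `|b|;
  starD : {morph star : a b / a + b};
  starZ : forall (c : R[i]) (a : A), star (c *: a) = (c^*)%R *: star a;
  starM : forall a b : A, star (cstar_mul a b) = cstar_mul (star b) (star a);
  starK : involutive star;
  cstar_norm : forall a : A, `|cstar_mul (star a) a| = `|a| ^+ 2 }.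

#[short(type="cstarAlgType")]
HB.structure Definition CStarAlgebra (R : realType) :=
  {A of CompleteNormedModule R[i] A & isCStarAlgebra R A}.

HB.instance Definition _ (R : realType) (A : cstarAlgType R) :=
  @GRing.Zmodule_isPzRing.Build (CStarAlgebra.sort A) (@cstar_one R A)
    (@cstar_mul R A) (@cstar_mulA R A) (@cstar_mul1l R A) (@cstar_mul1r R A)
    (@cstar_mulDl R A) (@cstar_mulDr R A).

(* C(T); R[i]^o is R[i] with the topology given by the modulus. The norm is
   only defined below, for T compact. *)
Definition Cfun (R : realType) (T : topologicalType) := continuousType T R[i]^o.

Section CfunRing.
Variables (R : realType) (T : topologicalType).
Local Notation C := R[i]^o.
Local Notation CT := (Cfun R T).

HB.instance Definition _ := Choice.copy CT (continuousType T C).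

Definition cfun (f : T -> C) (cf : continuous f) : CT := mkcts cf.

Lemma cfunP (f g : CT) : f =1 g -> f = g.
Proof. by move/continuousEP. Qed.

Lemma cfun_continuous (f : CT) : continuous (f : T -> C).
Proof. exact: cts_fun. Qed.

Let cadd_cts (f g : CT) : continuous (fun x => f x + g x : C).
Proof. by move=> x; apply: (@cvgD _ C); exact: cfun_continuous. Qed.
Let copp_cts (f : CT) : continuous (fun x => - f x : C).
Proof. by move=> x; apply: (@cvgN _ C); exact: cfun_continuous. Qed.
Let cmul_cts (f g : CT) : continuous (fun x => f x * g x : C).
Proof. by move=> x; apply: (@cvgM R[i]); exact: cfun_continuous. Qed.
Let cscale_cts (c : R[i]) (f : CT) : continuous (fun x => c * f x : C).
Proof.
by move=> x; apply: (@cvgM R[i]); [exact: cvg_cst|exact: cfun_continuous].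
Qed.
Let ccst_cts (c : R[i]) : continuous (fun _ : T => c : C).
Proof. by move=> x; exact: cvg_cst. Qed.
Let cstar_cts (f : CT) : continuous (fun x => Num.conj (f x) : C).
Proof.
by move=> x; apply: continuous_comp;
  [exact: cfun_continuous|exact: continuous_conj].
Qed.

Definition cfun_add (f g : CT) := cfun (@cadd_cts f g).
Definition cfun_opp (f : CT) := cfun (@copp_cts f).
Definition cfun_mul (f g : CT) := cfun (@cmul_cts f g).
Definition cfun_scale (c : R[i]) (f : CT) := cfun (@cscale_cts c f).
Definition cfun_cst (c : R[i]) := cfun (@ccst_cts c).
Definition cfun_star (f : CT) := cfun (@cstar_cts f).

Program Definition cfun_isZmodule :=
  @GRing.isZmodule.Build CT (cfun_cst 0) cfun_opp cfun_add _ _ _ _.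
Next Obligation. by move=> f g h; apply: cfunP => x; exact: addrA. Qed.
Next Obligation. by move=> f g; apply: cfunP => x; exact: addrC. Qed.
Next Obligation. by move=> f; apply: cfunP => x; exact: add0r. Qed.
Next Obligation. by move=> f; apply: cfunP => x; exact: addNr. Qed.
HB.instance Definition _ := cfun_isZmodule.

Program Definition cfun_isPzRing :=
  @GRing.Zmodule_isPzRing.Build CT (cfun_cst 1) cfun_mul _ _ _ _ _.
Next Obligation. by move=> f g h; apply: cfunP => x; exact: mulrA. Qed.
Next Obligation. by move=> f; apply: cfunP => x; exact: mul1r. Qed.
Next Obligation. by move=> f; apply: cfunP => x; exact: mulr1. Qed.
Next Obligation. by move=> f g h; apply: cfunP => x; exact: mulrDl. Qed.
Next Obligation. by move=> f g h; apply: cfunP => x; exact: mulrDr. Qed.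
HB.instance Definition _ := cfun_isPzRing.

Program Definition cfun_isComPzRing :=
  @GRing.PzRing_hasCommutativeMul.Build CT _.
Next Obligation. by move=> f g; apply: cfunP => x; exact: mulrC. Qed.
HB.instance Definition _ := cfun_isComPzRing.

Program Definition cfun_isLmodule :=
  @GRing.Zmodule_isLmodule.Build R[i] CT cfun_scale _ _ _ _.
Next Obligation. by move=> a b f; apply: cfunP => x; exact: mulrA. Qed.
Next Obligation. by move=> f; apply: cfunP => x; exact: mul1r. Qed.
Next Obligation. by move=> c f g; apply: cfunP => x; exact: mulrDr. Qed.
Next Obligation. by move=> f a b; apply: cfunP => x; exact: mulrDl. Qed.
HB.instance Definition _ := cfun_isLmodule.

Lemma cfunE (f : T -> C) (cf : continuous f) x : cfun cf x = f x.
Proof. by []. Qed.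
Lemma cfun0E (x : T) : (0 : CT) x = 0. Proof. by []. Qed.
Lemma cfun1E (x : T) : (1 : CT) x = 1. Proof. by []. Qed.
Lemma cfunDE (f g : CT) x : (f + g) x = f x + g x. Proof. by []. Qed.
Lemma cfunNE (f : CT) x : (- f) x = - f x. Proof. by []. Qed.
Lemma cfunBE (f g : CT) x : (f - g) x = f x - g x. Proof. by []. Qed.
Lemma cfunME (f g : CT) x : (f * g) x = f x * g x. Proof. by []. Qed.
Lemma cfunZE (c : R[i]) (f : CT) x : (c *: f) x = c * f x. Proof. by []. Qed.

End CfunRing.

Section CfunNorm.
Variables (R : realType) (T : compactHausdorffType).
Local Notation C := R[i]^o.
Local Notation CT := (Cfun R T).

(* 0 if T is empty, since sup set0 = 0. *)
Definition sup_norm (f : CT) : R[i] :=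
  (sup [set Re `|f x| | x in [set: T]])%:C.

Lemma cfun_has_ubound (f : CT) : has_ubound [set Re `|f x| | x in [set: T]].
Proof.
have [[t0 _]|T0] := pselect ([set: T] !=set0); last first.
  by exists 0 => _ [x _ <-]; case: T0; exists x.
have cf : {within [set: T], continuous (fun x => Re `|f x|)}.
  apply: continuous_subspaceT => x.
  apply: (@continuous_comp T C R (fun x => `|f x| : C)); last first.
    exact: continuous_Re.
  by apply: (@cvg_norm _ C); exact: cfun_continuous.
have [c _ fc] := compact_EVT_max (ex_intro _ t0 I) (@compact_univ T) cf.
by exists (Re `|f c|) => _ [x _ <-]; apply: fc; rewrite inE.
Qed.

Lemma sup_norm_ge (f : CT) x : `|f x| <= sup_norm f.
Proof.
rewrite -normc_Re lecR; apply: ub_le_sup; first exact: cfun_has_ubound.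
by exists x.
Qed.

Lemma sup_norm_ge0 (f : CT) : 0 <= sup_norm f.
Proof.
rewrite ler0c; have [[t0 _]|T0] := pselect ([set: T] !=set0).
  by rewrite -ler0c; apply: le_trans (sup_norm_ge f t0); exact: normr_ge0.
rewrite (_ : [set _ | _ in _] = set0) ?sup0//.
by rewrite -subset0 => _ [x _ <-]; apply: T0; exists x.
Qed.

Lemma sup_norm_le (f : CT) (e : R[i]) : 0 <= e ->
  (forall x, `|f x| <= e) -> sup_norm f <= e.
Proof.
move=> e0 fe; have eE : e = (Re e)%:C by rewrite RRe_real ?ger0_real.
rewrite eE lecR; have [[t0 _]|T0] := pselect ([set: T] !=set0).
  apply: ge_sup; first by exists (Re `|f t0|); exists t0.
  by move=> _ [x _ <-]; rewrite -lecR normc_Re -eE; exact: fe.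
rewrite (_ : [set _ | _ in _] = set0) ?sup0 -?ler0c -?eE//.
by rewrite -subset0 => _ [x _ <-]; apply: T0; exists x.
Qed.

Let sup_normD (f g : CT) : sup_norm (f + g) <= sup_norm f + sup_norm g.
Proof.
apply: sup_norm_le => [|x]; first by rewrite addr_ge0 ?sup_norm_ge0.
by rewrite (le_trans (ler_normD _ _))// lerD ?sup_norm_ge.
Qed.

Let sup_normZ (c : R[i]) (f : CT) : sup_norm (c *: f) = `|c| * sup_norm f.
Proof.
apply/eqP; rewrite eq_le; apply/andP; split.
  apply: sup_norm_le => [|x]; first by rewrite mulr_ge0 ?sup_norm_ge0.
  by rewrite cfunZE normrM ler_wpM2l ?sup_norm_ge.
have [->|c0] := eqVneq c 0; first by rewrite normr0 mul0r sup_norm_ge0.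
rewrite mulrC -ler_pdivlMr ?normr_gt0//; apply: sup_norm_le => [|x].
  by rewrite divr_ge0 ?sup_norm_ge0.
by rewrite ler_pdivlMr ?normr_gt0// mulrC -normrM; exact: (sup_norm_ge (c *: f)).
Qed.

Let sup_norm0_eq0 (f : CT) : sup_norm f = 0 -> f = 0.
Proof.
move=> f0; apply: cfunP => x; apply/eqP; rewrite -normr_le0 -f0.
exact: sup_norm_ge.
Qed.

HB.instance Definition _ := @Lmodule_isNormed.Build R[i] CT sup_norm
  sup_normD sup_normZ sup_norm0_eq0.

Lemma cfun_normE (f : CT) : `|f| = sup_norm f. Proof. by []. Qed.

Let cfun_complete (F : set_system CT) : ProperFilter F -> cauchy F -> cvg F.
Proof.
move=> FF /cauchy_ballP Fc.
have Fx x : cvg ((fun f : CT => f x : C) @ F).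
  apply: complex_cauchy_cvg; apply/cauchy_ballP => e e0.
  have [[A B] [FA FB] AB] := Fc _ e0.
  exists ((fun f : CT => f x : C) @` A, (fun f : CT => f x : C) @` B).
    split; rewrite /= nbhs_simpl; [apply: filterS FA|apply: filterS FB].
      by move=> z Az; exists z.
    by move=> z Bz; exists z.
  move=> [_ _] [/= [f Af <-] [g Bg <-]].
  have := AB (f, g) (conj Af Bg); rewrite -!ball_normE /=.
  by apply: le_lt_trans; exact: (sup_norm_ge (f - g)).
pose h x := lim ((fun f : CT => f x : C) @ F).
have Fh (e : R[i]) : 0 < e -> F [set f : CT | forall x, `|h x - f x| <= e].
  move=> e0; have [[A B] [FA FB] AB] := Fc _ e0.
  apply: filterS FA => f Af x.
  rewrite distrC; apply/ler_addgt0Pr => d d0.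
  have /(@cvgrPdist_lt _ C) /(_ _ d0) Fd := Fx x.
  have [g [Bg gd]] := filter_ex (filterI FB Fd).
  rewrite -(subrKA (g x)) (le_trans (ler_normD _ _))// lerD//.
    have := AB (f, g) (conj Af Bg); rewrite -ball_normE /= => /ltW.
    by apply: le_trans; exact: (sup_norm_ge (f - g)).
  by rewrite distrC ltW.
have ch : continuous (h : T -> C).
  move=> x; apply/(@cvgrPdist_lt _ C) => e e0.
  have e30 : 0 < e / 3%:R by rewrite divr_gt0 ?ltr0n.
  have [f fh] := filter_ex (Fh _ e30).
  have /(@cvgrPdist_lt _ C) /(_ _ e30) := @cfun_continuous R T f x.
  apply: filterS => y fxy.
  have -> : h x - h y = (h x - f x) + (f x - f y) - (h y - f y).
    by rewrite addrA subrK opprB addrA subrK.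
  have -> : e = e / 3%:R + e / 3%:R + e / 3%:R.
    transitivity (e / 3%:R * 3%:R); first by rewrite divfK ?pnatr_eq0.
    by move: (e / 3%:R) => d; rewrite mulr_natr !mulrS mulr0n addr0 addrA.
  rewrite (le_lt_trans (ler_normB _ _))// ltr_leD//.
  by rewrite (le_lt_trans (ler_normD _ _))// ler_ltD.
apply/cvg_ex; exists (cfun ch); apply/(@fcvgrPdist_lt _ CT) => e e0.
have e20 : 0 < e / 2%:R by rewrite divr_gt0.
apply: filterS (Fh _ e20) => f fh.
apply: (@le_lt_trans _ _ (e / 2%:R)); last first.
  by rewrite ltr_pdivrMr// mulr_natr mulr2n ltrDl.
by apply: sup_norm_le; [exact: ltW|exact: fh].
Qed.

HB.instance Definition _ := Uniform_isComplete.Build CT cfun_complete.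

Program Definition cfun_isCStarAlgebra :=
  @isCStarAlgebra.Build R CT ( *%R) 1 (@cfun_star R T)
    (@mulrA CT) (@mul1r CT) (@mulr1 CT) (@mulrDl CT) (@mulrDr CT)
    _ _ _ _ _ _ _ _.
Next Obligation.
by move=> c f g; apply: cfunP => x; apply/esym; exact: mulrA.
Qed.
Next Obligation. by move=> c f g; apply: cfunP => x; exact: mulrCA. Qed.
Next Obligation.
move=> f g; apply: sup_norm_le => [|x]; first by rewrite mulr_ge0.
by rewrite cfunME normrM ler_pM ?sup_norm_ge.
Qed.
Next Obligation. by move=> f g; apply: cfunP => x; exact: rmorphD. Qed.
Next Obligation. by move=> c f; apply: cfunP => x; exact: rmorphM. Qed.
Next Obligation.
by move=> f g; apply: cfunP => x; rewrite cfunE cfunME rmorphM mulrC.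
Qed.
Next Obligation. by move=> f; apply: cfunP => x; exact: conjCK. Qed.
Next Obligation.
move=> f; apply/eqP; rewrite eq_le; apply/andP; split.
  apply: sup_norm_le => [|x]; first by rewrite exprn_ge0.
  by rewrite cfunME cfunE normrM norm_conjC -expr2 lerXn2r ?nnegrE ?sup_norm_ge.
have sqf : `|f| <= sqrtC (sup_norm (cfun_star f * f)).
  apply: sup_norm_le => [|x]; first by rewrite sqrtC_ge0 sup_norm_ge0.
  rewrite -(@ler_pXn2r _ 2) ?nnegrE ?sqrtC_ge0 ?sup_norm_ge0// sqrtCK.
  rewrite expr2 -{1}[`|f x|]norm_conjC -normrM.
  exact: (sup_norm_ge (cfun_star f * f)).
by rewrite -[leRHS]sqrtCK lerXn2r ?nnegrE ?sqrtC_ge0 ?sup_norm_ge0.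
Qed.
HB.instance Definition _ := cfun_isCStarAlgebra.

End CfunNorm.

Section StarAlgebraMaps.
Variable R : realType.
Implicit Types A B : cstarAlgType R.

Definition star_hom A B (f : A -> B) : Prop :=
  [/\ linear f, {morph f : a b / a * b} & {morph f : a / star a}].

Definition star_mx A n (M : 'M[A]_n) : 'M[A]_n := (map_mx (@star R A) M)^T.

Definition mx_invertible A n (M : 'M[A]_n) : Prop :=
  exists N : 'M[A]_n, M *m N = 1%:M /\ N *m M = 1%:M.

Definition mx_spectrum A n (M : 'M[A]_n) : set R[i] :=
  [set l | ~ mx_invertible (M - (l *: (1 : A))%:M)].

(* Positivity in the C*-algebra M_n(A): self-adjoint with spectrum in
   [0, +oo[; recall that 0 <= l in R[i] means that l is real and
   nonnegative. *)
Definition mx_positive A n (M : 'M[A]_n) : Prop :=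
  star_mx M = M /\ forall l, mx_spectrum M l -> 0 <= l.

Definition completely_positive A B (f : A -> B) : Prop :=
  linear f /\
  forall n (M : 'M[A]_n), mx_positive M -> mx_positive (map_mx f M).

Definition closed_star_ideal A (I : set A) : Prop :=
  [/\ closed I, I 0, forall a b, I a -> I b -> I (a + b),
      forall a b, I b -> I (a * b) /\ I (b * a) & forall a, I a -> I (star a)].

(* The annihilator form of essentiality; it makes the big algebra embed into
   the multiplier algebra of the ideal. *)
Definition essential A (I : set A) : Prop :=
  forall m : A, (forall a, I a -> m * a = 0) -> m = 0.

End StarAlgebraMaps.

(* The quotient of the big algebra by the ideal is represented, up to its
   canonical isomorphism, by a C*-algebra nc_bd with a surjective
   *-homomorphism onto it whose kernel is the ideal. *)
Record nc_coarse_space (R : realType) := NCCoarseSpace {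
  nc_alg : cstarAlgType R;
  nc_ideal : set nc_alg;
  nc_idealP : closed_star_ideal nc_ideal;
  nc_essential : essential nc_ideal;
  nc_bd : cstarAlgType R;
  nc_quot : nc_alg -> nc_bd;
  nc_quot_hom : star_hom nc_quot;
  nc_quot_surj : forall b, exists a, nc_quot a = b;
  nc_quot_ker : forall a, nc_quot a = 0 <-> nc_ideal a }.

Arguments nc_ideal {R} n _ : rename.
Arguments nc_quot {R} n _ : rename.

Section Strict.
Variables (R : realType) (A : nc_coarse_space R).

Definition strict_eval (m : nc_alg A) :
    {ptws nc_ideal A -> (nc_alg A * nc_alg A)%type} :=
  fun a => (m * \val a, \val a * m).

(* The big algebra with the restriction of the strict topology of the
   multiplier algebra of the ideal, i.e. the topology generated by the
   seminorms m |-> `|m * a| and m |-> `|a * m| for a in the ideal. *)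
Definition strict := initial_topology strict_eval.

End Strict.

Record nc_coarse_map (R : realType) (A B : nc_coarse_space R) := NCCoarseMap {
  ncm_ideal : nc_ideal A -> nc_ideal B;
  ncm_alg : nc_alg A -> nc_alg B;
  ncm_bd : nc_bd A -> nc_bd B;
  ncm_incl : forall a, \val (ncm_ideal a) = ncm_alg (\val a);
  ncm_quot : forall a, ncm_bd (nc_quot A a) = nc_quot B (ncm_alg a);
  ncm_unital : ncm_alg 1 = 1;
  ncm_cp : completely_positive ncm_alg;
  ncm_strict : continuous (ncm_alg : strict A -> strict B);
  ncm_bd_hom : star_hom ncm_bd }.

Definition nc_close (R : realType) (A B : nc_coarse_space R)
  (phi psi : nc_coarse_map A B) : Prop := ncm_bd phi = ncm_bd psi.

(* The locally compact space is identified with its image inner, a dense open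
   subset of the compact Hausdorff space whole. *)
Record compactified := Compactified {
  whole :> compactHausdorffType;
  inner : set whole;
  inner_open : open inner;
  inner_dense : dense inner;
  inner_loc_compact : locally_compact [set: inner] }.

Arguments inner X _ : clear implicits, rename.

Definition boundary (X : compactified) : Type := set_type (~` inner X).

Section Boundary.
Variable X : compactified.

HB.instance Definition _ :=
  Topological.copy (boundary X) (set_type (~` inner X)).

Definition bdval (x : boundary X) : X := \val x.

Lemma bdvalP (x : boundary X) : ~ inner X (bdval x).
Proof. exact: (set_valP x). Qed.

Definition bdmk (x : X) (xbd : ~ inner X x) : boundary X :=
  exist _ x (mem_set xbd).

Lemma bdval_inj : injective bdval.
Proof. exact: val_inj. Qed.

Lemma bdmkK x xbd : bdval (@bdmk x xbd) = x.
Proof. by []. Qed.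

Lemma bdval_continuous : continuous bdval.
Proof. exact: initial_continuous. Qed.

Lemma nbhs_bdP (x : boundary X) (U : set (boundary X)) :
  nbhs x U <-> exists2 V : set X, nbhs (bdval x) V & bdval @^-1` V `<=` U.
Proof.
split=> [[_ [[W oW <-] /= Wx WU]]|[V Vx VU]].
  by exists W => //; exact: open_nbhs_nbhs.
apply: filterS VU _; exact: bdval_continuous.
Qed.

Lemma boundary_closed : closed (~` inner X).
Proof. exact/open_closedC/inner_open. Qed.

Let boundary_compact : compact [set: boundary X].
Proof.
move=> F FF _.
have cB : compact (~` inner X).
  by apply: (subclosed_compact boundary_closed (@compact_univ X)).
have FB : (bdval @ F) (~` inner X).
  by apply: (@filterS _ F _ setT _ _ filterT) => x _; exact: (bdvalP (x := x)).
have [p [pB pF]] := cB _ _ FB.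
exists (bdmk pB); split => // A N FA /nbhs_bdP[V Vp VN].
have [_ [[a Aa <-] Va]] : (bdval @` A) `&` V !=set0.
  apply: pF => //; rewrite /= nbhs_simpl; apply: filterS FA => a Aa.
  by exists a.
by exists a; split => //; exact: VN.
Qed.

Let boundary_hausdorff : hausdorff_space (boundary X).
Proof.
move=> p q pq; apply: bdval_inj; apply: (@hausdorff_univ X) => U V pU qV.
have [x [Ux Vx]] := pq _ _ (bdval_continuous pU) (bdval_continuous qV).
by exists (bdval x).
Qed.

HB.instance Definition _ :=
  isCompactHausdorff.Build (boundary X) boundary_compact boundary_hausdorff.

End Boundary.

Section CfunMaps.
Variable R : realType.

Definition cfun_comp (S T : topologicalType) (u : S -> T) (cu : continuous u)
    (h : Cfun R T) : Cfun R S :=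
  cfun (fun x => @continuous_comp S T R[i]^o u h x (cu x)
    (@cfun_continuous R T h (u x))).

Lemma cfun_compE (S T : topologicalType) (u : S -> T) (cu : continuous u)
  (h : Cfun R T) x : cfun_comp cu h x = h (u x).
Proof. by []. Qed.

Lemma cfun_comp_star_hom (S T : compactHausdorffType) (u : S -> T)
  (cu : continuous u) : star_hom (cfun_comp cu : Cfun R T -> Cfun R S).
Proof. by split=> [c f g|f g|f]; apply: cfunP. Qed.

End CfunMaps.

Section C0.
Variables (R : realType) (X : compactified).

(* The elements of C_0(X), extended by zero to the compactification. *)
Definition C0 : set (Cfun R X) :=
  [set f | (forall x, ~ inner X x -> f x = 0) /\
     forall e : R, 0 < e -> exists K : set X,
       [/\ compact K, K `<=` inner X &
           forall x, inner X x -> ~ K x -> `|f x| < e%:C]].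

Lemma C0P (f : Cfun R X) : C0 f <-> forall x, ~ inner X x -> f x = 0.
Proof.
split=> [[]//|f0]; split=> // e e0.
have cK : closed [set x : X | e%:C <= `|f x|].
  rewrite (_ : [set _ | _] = (fun x : X => Re `|f x|) @^-1` [set r | e <= r]).
    apply: preimage_closed (@closed_ge R e) => x _.
    apply: (@continuous_comp X R[i]^o R (fun x => `|f x| : R[i]^o)).
      by apply: (@cvg_norm _ R[i]^o); exact: cfun_continuous.
    exact: continuous_Re.
  by apply/seteqP; split=> x /=; rewrite -normc_Re lecR.
exists [set x | e%:C <= `|f x|]; split.
- exact: (subclosed_compact cK (@compact_univ X)).
- move=> x /= ex; apply: contrapT => /f0 fx0; move: ex.
  by rewrite fx0 normr0 lecR leNgt e0.
- by move=> x _ /= /negP; rewrite real_ltNge ?normr_real ?ger0_real// lecR ltW.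
Qed.

Let C0_ideal : closed_star_ideal C0.
Proof.
split.
- move=> f fcl; apply/C0P => x xbd; apply/eqP; rewrite -normr_le0.
  apply/ler_addgt0Pr => e e0; rewrite add0r.
  have fe : nbhs f (ball f e) by exact: nbhsx_ballx.
  have [g [/C0P g0]] := fcl _ fe; rewrite -ball_normE /= => fg.
  have := sup_norm_ge (f - g) x; rewrite cfunBE g0// subr0 => /le_trans; apply.
  exact: ltW.
- by apply/C0P.
- move=> f g /C0P f0 /C0P g0; apply/C0P => x xbd.
  by rewrite cfunDE f0// g0// addr0.
- move=> f g /C0P g0; split; apply/C0P => x xbd; rewrite cfunME g0//.
    by rewrite mulr0.
  by rewrite mul0r.
- by move=> f /C0P f0; apply/C0P => x xbd; rewrite cfunE f0// rmorph0.
Qed.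

Let whole_normal : normal_space X.
Proof. exact: (compact_normal (@hausdorff_univ X) (@compact_univ X)). Qed.

Let C0_essential : essential C0.
Proof.
move=> m m0; apply: cfunP => x0; apply: contrapT => mx0.
have om : open [set x : X | m x != 0].
  rewrite (_ : [set _ | _] = (fun x : X => m x : R[i]^o) @^-1` (~` [set 0])).
    apply: open_comp; first by move=> x _; exact: cfun_continuous.
    apply: closed_openC; apply: accessible_closed_set1.
    apply: hausdorff_accessible; exact: norm_hausdorff.
  by apply/seteqP; split=> x /= /eqP.
have [x [mx xin]] : [set x : X | m x != 0] `&` inner X !=set0.
  by apply: inner_dense => //; exists x0; apply/eqP.
have c1 : closed [set x].
  by apply: accessible_closed_set1; exact: hausdorff_accessible hausdorff_univ.
have [|g [cg g0 g1 _]] := urysohn_ext_itv whole_normal (@boundary_closed X) c1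
    _ (@ltr01 R).
  by rewrite -subset0 => y [/= yn yx]; apply: yn; rewrite yx.
pose a : Cfun R X := cfun (continuous_real_complex cg).
have C0a : C0 a.
  apply/C0P => y ybd; rewrite cfunE (_ : g y = 0)//.
  by apply: g0; exists y.
have := congr1 (fun h : Cfun R X => h x) (m0 _ C0a).
rewrite /= cfunME cfunE (_ : g x = 1); last by apply: g1; exists x.
by rewrite mulr1 => /eqP; rewrite (negbTE mx).
Qed.

Definition restrict_bd : Cfun R X -> Cfun R (boundary X) :=
  cfun_comp (@bdval_continuous X).

Let restrict_bd_surj (h : Cfun R (boundary X)) : exists f, restrict_bd f = h.
Proof.
have ext (u : boundary X -> R) : continuous u ->
    (exists M, forall x, `|u x| <= M) ->
    exists2 g : X -> R, continuous g & forall x, g (bdval x) = u x.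
  move=> cu [M uM].
  have cw : {within ~` inner X, continuous (valL_ (0 : R) u)}.
    exact/subspace_valL_continuousP'.
  have vE (x : boundary X) : valL_ 0 u (bdval x) = u x.
    exact: (congr1 (fun v => v x) (@valLK _ _ (0 : R) (~` inner X) u)).
  have M0 : 0 < `|M| + 1 by rewrite ltr_wpDl.
  have bw x : (~` inner X) x -> `|valL_ 0 u x| <= `|M| + 1.
    move=> xbd; rewrite -[x](bdmkK xbd) vE (le_trans (uM _))//.
    by rewrite (le_trans (ler_norm _))// lerDl.
  have [g [gE cg _]] := continuous_bounded_extension whole_normal
    (@boundary_closed X) M0 cw bw.
  exists g => // x; rewrite -vE gE//; apply/mem_set; exact: bdvalP.
have [M hM] := cfun_has_ubound h.
have hb x : Re `|h x| <= M by apply: hM; exists x.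
have [u cu uE] : exists2 g : X -> R, continuous g &
    forall x, g (bdval x) = Re (h x).
  apply: ext; last first.
    by exists M => x; exact: le_trans (Re_normc_le _) (hb x).
  move=> x; apply: (@continuous_comp (boundary X) R[i]^o R h).
    exact: cfun_continuous.
  exact: continuous_Re.
have [v cv vE] : exists2 g : X -> R, continuous g &
    forall x, g (bdval x) = Im (h x).
  apply: ext; last first.
    by exists M => x; exact: le_trans (Im_normc_le _) (hb x).
  move=> x; apply: (@continuous_comp (boundary X) R[i]^o R h).
    exact: cfun_continuous.
  exact: continuous_Im.
have cf : continuous (fun x : X => u x +i* v x : R[i]^o).
  by move=> x; apply: cvg_Complex; [exact: cu|exact: cv].
exists (cfun cf); apply: cfunP => x; rewrite cfun_compE cfunE uE vE.
by case: (h x).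
Qed.

Let restrict_bd_ker (f : Cfun R X) : restrict_bd f = 0 <-> C0 f.
Proof.
split=> [f0|/C0P f0].
  by apply/C0P => x xbd; have /continuousEP/(_ (bdmk xbd)) := f0.
by apply: cfunP => x; rewrite cfun_compE f0//; exact: bdvalP.
Qed.

Definition C0_coarse : nc_coarse_space R :=
  NCCoarseSpace C0_ideal C0_essential
    (cfun_comp_star_hom R (@bdval_continuous X))
    restrict_bd_surj restrict_bd_ker.

End C0.

Record S_obj := SObj {
  S_cpt :> compactified;
  S_sigma_compact : exists K : nat -> set S_cpt,
    (forall n, compact (K n)) /\ \bigcup_n K n = inner S_cpt }.

Record S_mor (X Y : S_obj) := SMor {
  S_map :> X -> Y;
  S_map_inner : forall x, inner X x -> inner Y (S_map x);
  S_map_boundary : forall x, ~ inner X x -> ~ inner Y (S_map x);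
  S_map_continuous : forall x, ~ inner X x -> {for x, continuous S_map} }.

Arguments S_map_inner {X Y} s x _.
Arguments S_map_boundary {X Y} s x _.
Arguments S_map_continuous {X Y} s x _.

(* Objects of the full subcategory S_p; its morphisms are those of S. *)
Definition in_Sp (X : S_obj) : Prop :=
  exists U V : set (X * X),
    [/\ open U, open V, U `&` V = set0,
        [set xy | inner X xy.1 /\ xy.1 = xy.2] `<=` U &
        [set xy | xy.1 <> xy.2 /\ (~ inner X xy.1 \/ ~ inner X xy.2)] `<=` V].

Section BoundaryMap.
Variables (R : realType) (X Y : S_obj) (F : S_mor X Y).

Definition boundary_map (x : boundary X) : boundary Y :=
  bdmk (S_map_boundary F (bdval x) (bdvalP (x := x))).

Lemma boundary_map_continuous : continuous boundary_map.
Proof.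
move=> x U /nbhs_bdP[V Vx VU]; apply/nbhs_bdP.
exists (F @^-1` V); first exact: (S_map_continuous F _ (bdvalP (x := x))).
by move=> y Vy; apply: (VU (boundary_map y)).
Qed.

Definition boundary_pullback : Cfun R (boundary Y) -> Cfun R (boundary X) :=
  cfun_comp boundary_map_continuous.

End BoundaryMap.

Definition S_close (X Y : S_obj) (F1 F2 : S_mor X Y) : Prop :=
  boundary_map F1 = boundary_map F2.

Definition corresponds (R : realType) (X Y : S_obj)
    (phi : nc_coarse_map (C0_coarse R Y) (C0_coarse R X)) (F : S_mor X Y) :
    Prop :=
  ncm_bd phi = boundary_pullback (R := R) F.

(* Main.v *)
Require Import Defs.
From mathcomp Require Import reals.
From mathcomp Require Import all_boot all_order all_algebra.
From mathcomp Require Import complex.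
From mathcomp Require Import all_classical all_reals all_analysis.

Set Implicit Arguments.
Unset Strict Implicit.
Unset Printing Implicit Defensive.

Import Order.TTheory GRing.Theory Num.Theory.
Import numFieldNormedType.Exports.

Local Open Scope classical_set_scope.
Local Open Scope ring_scope.
Local Open Scope complex_scope.

(** Pulling back along F itself does not work, as F need not be continuous on
    X. Instead F is smeared out: choose points s_n of X and a locally finite
    partition of unity chi_n on X, and put
      phi(h)(x) = sum_n chi_n(x) h(F(s_n))   for x in X,
      phi(h)(x) = h(F(x))                    for x in the boundary.

    The condition defining S_p makes this continuous at the boundary. It
    provides an open neighbourhood U of the diagonal of X whose closure meets
    the pairs with a boundary point only in the diagonal; so if x_n and z_n are
    U-close and x_n tends to a boundary point, then z_n tends to the same
    point ([Sp_controlled]). If chi_n is supported in the points U-close to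
    s_n, then near a boundary point x only the values of h o F near x enter the
    average, and h o F is continuous at x.

    The partition of unity is chi_n = g_n prod_(m < n) (1 - g_m), for
    functions g_n with values in [0, 1] such that the interiors of the sets
    {g_n = 1} cover X; countably many g_n suffice as X is sigma-compact
    ([lindelof_seq]). These partial sums telescope, all chi_n vanish after an
    index with g_n(x) = 1, and no infinite sum or division is needed.

    Each phi(h)(x) is a finite nonnegative combination of values of h. Hence
    phi is linear, and it is completely positive because positivity in
    M_n(C(T)) can be tested pointwise, where it is positive semidefiniteness
    ([mx_positiveP], which rests on the spectral theorem for matrices).

    Strict continuity: for b in C_0(X), an a in C_0(Y) with
    |phi(h) b| <= |h a| is needed. For every k, only finitely many chi_n are
    nonzero somewhere on the compact set {|b| >= 2^-k}; it is enough that a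
    dominates 2^-k at the corresponding points F(s_n), and a function with this
    property for all k is a supremum of Urysohn functions weighted by 2^-k
    ([C0_dominating]).

    Finally, a map corresponding to F has boundary part h |-> h o dF, and this
    determines dF since continuous functions separate the points of the
    compact Hausdorff space dY ([boundary_pullback_close]). *)

Local Open Scope sesquilinear_scope.

(** * Positive semidefinite complex matrices *)

Definition mx_psd (C : numClosedFieldType) n (M : 'M[C]_n) : Prop :=
  forall v : 'rV_n, 0 <= (v *m M *m v^t*) 0 0.

Lemma eigenvalue_unitmx (F : fieldType) n (M : 'M[F]_n) (l : F) :
  eigenvalue M l = (M - l%:M \notin unitmx).
Proof. by rewrite /eigenvalue /eigenspace kermx_eq0 row_free_unit. Qed.

Lemma mul_adjmx_ge0 (C : numClosedFieldType) n (v : 'rV[C]_n) :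
  0 <= (v *m v^t*) 0 0.
Proof.
rewrite mxE sumr_ge0// => j _; rewrite !mxE; exact: mul_conjC_ge0.
Qed.

Lemma mul_adjmx_gt0 (C : numClosedFieldType) n (v : 'rV[C]_n) :
  v != 0 -> 0 < (v *m v^t*) 0 0.
Proof.
move=> v0; rewrite lt_def mul_adjmx_ge0 andbT; apply: contra v0.
rewrite mxE psumr_eq0 => [/allP v0|j _]; last first.
  by rewrite !mxE mul_conjC_ge0.
apply/eqP/rowP => j; have := v0 j (mem_index_enum _).
by rewrite !mxE mul_conjC_eq0 => /eqP.
Qed.

Lemma psd_eigenvalue_ge0 (C : numClosedFieldType) n (M : 'M[C]_n) (l : C) :
  mx_psd M -> eigenvalue M l -> 0 <= l.
Proof.
move=> Mpos /eigenvalueP[v vM v0]; have := Mpos v.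
by rewrite vM -scalemxAl mxE pmulr_lge0// mul_adjmx_gt0.
Qed.

(** Diagonalise M in a unitary basis: v M v* becomes a combination of the
    eigenvalues with coefficients |w_j|^2. *)
Lemma hermitian_psd (C : numClosedFieldType) n (M : 'M[C]_n) :
  M^t* = M -> (forall l, eigenvalue M l -> 0 <= l) -> mx_psd M.
Proof.
move=> Mh Mev v.
have /orthomx_spectralP : M \is normalmx by apply/normalmxP; rewrite Mh.
set P := spectralmx M; set D := spectral_diag M => ME.
have PU : P \is unitarymx by exact: spectral_unitarymx.
have D0 j : 0 <= D 0 j.
  (* The rows of the diagonalising unitary are eigenvectors. *)
  apply: Mev; apply/eigenvalueP; exists (row j P).
    rewrite -row_mul ME !mulmxA mulmxV ?spectral_unit// mul1mx.
    by rewrite row_mul row_diag_mx -scalemxAl -rowE.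
  apply/negP => /eqP rP; have := spectral_unit M; rewrite -row_free_unit.
  move=> /row_freeP[Q /(congr1 (row j))]; rewrite row_mul -/P rP mul0mx.
  by move=> /rowP/(_ j)/eqP; rewrite !mxE eqxx eq_sym oner_eq0.
rewrite ME invmx_unitary// !mulmxA -mulmxA.
have -> : P *m v^t* = (v *m P^t*)^t* by rewrite trmx_mul map_mxM trmxCK.
set w := v *m _; rewrite mxE sumr_ge0// => j _.
by rewrite mul_mx_diag !mxE mulrAC mulr_ge0// mul_conjC_ge0.
Qed.

(** * Positivity in matrix algebras over C(T) *)

Section PointwisePositivity.
Variables (R : realType) (T : compactHausdorffType).
Local Notation A := (Cfun R T : cstarAlgType R).

Definition mx_at n (M : 'M[A]_n) (x : T) : 'M[R[i]]_n :=
  map_mx (fun f : Cfun R T => f x) M.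

Lemma cfun_sumE (I : Type) (r : seq I) (P : pred I) (F : I -> Cfun R T) x :
  (\sum_(i <- r | P i) F i) x = \sum_(i <- r | P i) F i x.
Proof. by elim/big_rec2 : _ => // i a b _ <-. Qed.

Lemma cfun_prodE (I : Type) (r : seq I) (P : pred I) (F : I -> Cfun R T) x :
  (\prod_(i <- r | P i) F i) x = \prod_(i <- r | P i) F i x.
Proof. by elim/big_rec2 : _ => // i a b _ <-. Qed.

Lemma mx_at_mul n (M N : 'M[A]_n) x : mx_at (M *m N) x = mx_at M x *m mx_at N x.
Proof.
apply/matrixP => i j; rewrite !mxE.
transitivity (\sum_k ((M i k : Cfun R T) x * (N k j : Cfun R T) x)).
  exact: cfun_sumE.
by apply: eq_bigr => k _; rewrite !mxE.
Qed.

Lemma mx_at_inj n (M N : 'M[A]_n) : (forall x, mx_at M x = mx_at N x) -> M = N.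
Proof.
move=> MN; apply/matrixP => i j; apply: cfunP => x.
by have /matrixP/(_ i j) := MN x; rewrite !mxE.
Qed.

Lemma mx_at_scalar n (f : Cfun R T) x : mx_at (f%:M : 'M[A]_n) x = (f x)%:M.
Proof. by apply/matrixP => i j; rewrite !mxE; case: eqP. Qed.

Lemma mx_at_star n (M : 'M[A]_n) x : mx_at (star_mx M) x = (mx_at M x)^t*.
Proof. by apply/matrixP => i j; rewrite !mxE. Qed.

Lemma cfun_det n (M : 'M[Cfun R T]_n) x :
  (\det M) x = \det (mx_at M x).
Proof.
rewrite /determinant cfun_sumE; apply: eq_bigr => s _.
rewrite cfunME cfun_prodE; congr (_ * _).
  by case: (perm.odd_perm s); rewrite ?expr0 ?expr1.
by apply: eq_bigr => i _; rewrite !mxE.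
Qed.

Lemma cfun_invertible (f : Cfun R T) :
  (forall x, f x != 0) -> exists g : Cfun R T, f * g = 1.
Proof.
move=> f0.
have cg : continuous (fun x => (f x)^-1 : R[i]^o).
  move=> x; apply: (@cvgV R[i]^o) => //; exact: cfun_continuous.
by exists (cfun cg); apply: cfunP => x; rewrite cfunME cfunE mulfV.
Qed.

(** The inverse is the adjugate over the determinant, which is continuous in x;
    so pointwise inverses of a continuous matrix function fit together. *)
Lemma mx_invertibleP n (M : 'M[A]_n) :
  mx_invertible M <-> forall x, mx_at M x \in unitmx.
Proof.
split=> [[N [MN _]] x|Mu].
  have /mulmx1_unit[]// : mx_at M x *m mx_at N x = 1%:M.
  by rewrite -mx_at_mul MN mx_at_scalar.
have [|g detg] := @cfun_invertible (\det (M : 'M[Cfun R T]_n)).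
  by move=> x; rewrite cfun_det -unitfE -unitmxE.
exists (g *: \adj (M : 'M[Cfun R T]_n)).
have E1 : (M : 'M[Cfun R T]_n) *m (g *: \adj (M : 'M[Cfun R T]_n)) = 1%:M.
  by rewrite -scalemxAr mul_mx_adj scale_scalar_mx mulrC detg.
have E2 : (g *: \adj (M : 'M[Cfun R T]_n)) *m (M : 'M[Cfun R T]_n) = 1%:M.
  by rewrite -scalemxAl mul_adj_mx scale_scalar_mx mulrC detg.
by split; [exact: E1|exact: E2].
Qed.

Lemma mx_spectrumP n (M : 'M[A]_n) l :
  mx_spectrum M l <-> exists x, eigenvalue (mx_at M x) l.
Proof.
have E x : (mx_at (M - (l *: (1 : A))%:M) x \in unitmx) =
    ~~ eigenvalue (mx_at M x) l.
  rewrite eigenvalue_unitmx negbK; congr (_ \in unitmx).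
  apply/matrixP => i j; rewrite !mxE cfunDE cfunNE.
  by case: (i == j); rewrite ?mulr1n ?mulr0n// cfunZE cfun1E mulr1.
split=> [Msp|[x Mx] /mx_invertibleP/(_ x)]; last by rewrite E Mx.
apply: contrapT => /forallNP Mev; apply: Msp.
by apply/mx_invertibleP => x; rewrite E; apply/negP; exact: Mev.
Qed.

(** The spectrum of M is the union of the spectra of its values, and a Hermitian
    complex matrix has nonnegative spectrum iff it is positive semidefinite.
    The latter condition is visibly stable under sums. *)
Lemma mx_positiveP n (M : 'M[A]_n) :
  mx_positive M <->
  forall x, (mx_at M x)^t* = mx_at M x /\ mx_psd (mx_at M x).
Proof.
split=> [[Mh Msp] x|MT].
  have Mxh : (mx_at M x)^t* = mx_at M x by rewrite -mx_at_star Mh.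
  split=> //; apply: hermitian_psd => // l Ml; apply: Msp.
  by apply/mx_spectrumP; exists x.
split; first by apply: mx_at_inj => x; rewrite mx_at_star (MT x).1.
by move=> l /mx_spectrumP[x]; apply: psd_eigenvalue_ge0; exact: (MT x).2.
Qed.

End PointwisePositivity.

(** Every point of T sees only a finitely supported positive measure on S. The
    measure and the size of its support may depend on the point in any way. *)
Definition finite_averaging (R : realType) (S T : compactHausdorffType)
    (f : Cfun R S -> Cfun R T) : Prop :=
  forall x : T, exists N (c : nat -> R) (y : nat -> S),
    (forall k, 0 <= c k) /\
    forall h : Cfun R S, f h x = \sum_(k < N) (c k)%:C * h (y k).

Lemma finite_averaging_linear (R : realType) (S T : compactHausdorffType)
  (f : Cfun R S -> Cfun R T) : finite_averaging f -> linear f.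
Proof.
move=> fE a g h; apply: cfunP => x; have [N [c [y [_ fx]]]] := fE x.
rewrite cfunDE cfunZE !fx mulr_sumr -big_split/=; apply: eq_bigr => k _.
by rewrite cfunDE cfunZE mulrDr mulrCA.
Qed.

Lemma finite_averaging_cp (R : realType) (S T : compactHausdorffType)
  (f : Cfun R S -> Cfun R T) : finite_averaging f ->
  @completely_positive R (Cfun R S) (Cfun R T) f.
Proof.
move=> fE; split; first exact: finite_averaging_linear.
move=> n M /mx_positiveP MP; apply/mx_positiveP => x.
have [N [c [y [c0 fx]]]] := fE x.
have E : mx_at (map_mx f M) x = \sum_(k < N) (c k)%:C *: mx_at M (y k).
  apply/matrixP => i j; rewrite !mxE fx summxE; apply: eq_bigr => k _.
  by rewrite !mxE.
have cC k : ((c k)%:C)^* = (c k)%:C by rewrite conjc_real.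
rewrite E; split.
  apply/matrixP => i j; rewrite !mxE !summxE rmorph_sum; apply: eq_bigr => k _.
  have /matrixP/(_ i j) := (MP (y k)).1; rewrite !mxE => <-.
  rewrite rmorphM; congr (_ * _); exact: cC.
move=> v; rewrite mulmx_sumr mulmx_suml summxE sumr_ge0// => k _.
rewrite -scalemxAr -scalemxAl mxE mulr_ge0 ?ler0c//; exact: (MP (y k)).2.
Qed.

(** * Strict continuity *)

Lemma near_strict (R : realType) (A : nc_coarse_space R) (m : strict A)
    (a : nc_alg A) (e : R[i]) : nc_ideal A a -> 0 < e ->
  \forall n \near m, `|((n : nc_alg A) - (m : nc_alg A)) * a| < e /\
                     `|a * ((n : nc_alg A) - (m : nc_alg A))| < e.
Proof.
move=> Aa e0; pose a' : nc_ideal A := exist _ a (mem_set Aa).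
have Fm : Filter (@strict_eval R A @ m).
  exact: (fmap_filter _ (@nbhs_filter (strict A) m)).
have := (pointwise_cvgP _ Fm).1
  (@initial_continuous _ _ (@strict_eval R A) m) a'.
move=> /(_ (ball ((m : nc_alg A) * a, a * (m : nc_alg A)) e)).
rewrite /= nbhs_simpl /= => /(_ (nbhsx_ballx _ _ e0)).
apply: (@filterS _ _ (@nbhs_filter (strict A) m)) => n [/=].
rewrite -!ball_normE /= => n1 n2.
by rewrite distrC in n1; rewrite distrC in n2; rewrite mulrBl mulrBr.
Qed.

(** A bound by a single seminorm on the source for each seminorm on the target
    is the usual continuity criterion for linear maps between locally convex
    spaces. *)
Lemma strict_continuous (R : realType) (A B : nc_coarse_space R)
    (f : nc_alg A -> nc_alg B) : linear f ->
    (forall b, nc_ideal B b -> exists2 a, nc_ideal A a &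
      forall h, `|f h * b| <= `|h * a| /\ `|b * f h| <= `|a * h|) ->
  continuous (f : strict A -> strict B).
Proof.
move=> flin fdom.
have fB (u v : nc_alg A) : f u - f v = f (u - v).
  by have := flin 1 (u - v) v; rewrite !scale1r subrK => ->; rewrite addrK.
apply: continuous_comp_initial => m.
apply/(pointwise_cvgP _ (fmap_filter _ (@nbhs_filter (strict A) m))) => -[b Bb].
have [a Aa fab] := fdom b (set_mem Bb).
apply/cvg_ballP => e e0.
have := near_strict m Aa e0.
apply: (@filterS _ _ (@nbhs_filter (strict A) m)) => n [n1 n2].
split; rewrite -ball_normE /= distrC.
  by rewrite -mulrBl fB; apply: le_lt_trans n1; exact: (fab _).1.
by rewrite -mulrBr fB; apply: le_lt_trans n2; exact: (fab _).2.
Qed.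

(** Agreement with F over the boundary makes f map C_0(Y) into C_0(X) and makes
    it induce the pullback along the boundary map, which is a
    *-homomorphism. *)
Lemma coarse_map_exists (R : realType) (X Y : S_obj) (F : S_mor X Y)
    (f : Cfun R Y -> Cfun R X) : finite_averaging f -> f 1 = 1 ->
    (forall h x, ~ inner X x -> f h x = h (F x)) ->
    (forall b, C0 b -> exists2 a : Cfun R Y, C0 a &
      forall h x, `|f h x * b x| <= `|h * a|) ->
  exists phi : nc_coarse_map (C0_coarse R Y) (C0_coarse R X), corresponds phi F.
Proof.
move=> favg f1 fbd fdom.
have fC0 (a : Cfun R Y) : C0 a -> C0 (f a).
  move=> /C0P a0; apply/C0P => x xbd; rewrite fbd// a0//.
  exact: (S_map_boundary F _ xbd).
pose fI (a : nc_ideal (C0_coarse R Y)) : nc_ideal (C0_coarse R X) :=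
  exist _ (f (\val a)) (mem_set (fC0 _ (set_valP a))).
unshelve eexists (@NCCoarseMap R (C0_coarse R Y) (C0_coarse R X) fI f
  (boundary_pullback (R := R) F) _ _ _ _ _ _).
- by [].
- by move=> h; apply: cfunP => x; apply/esym/fbd/bdvalP.
- exact: f1.
- exact: finite_averaging_cp.
- apply: strict_continuous; first exact: finite_averaging_linear.
  move=> b /fdom[a a0 fab]; exists a => // h.
  have le : sup_norm (f h * b) <= `|h * a|.
    by apply: sup_norm_le => // x; exact: fab.
  split; first exact: le.
  have -> : @GRing.mul (nc_alg (C0_coarse R X)) b (f h) = f h * b :> Cfun R X.
    exact: (@mulrC (Cfun R X)).
  have -> : @GRing.mul (nc_alg (C0_coarse R Y)) a h = h * a :> Cfun R Y.
    exact: (@mulrC (Cfun R Y)).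
  exact: le.
- exact: cfun_comp_star_hom.
- by [].
Qed.

(** * Separation in compact Hausdorff spaces *)

Lemma compactHausdorff_normal (T : compactHausdorffType) : normal_space T.
Proof. exact: (compact_normal (@hausdorff_univ T) (@compact_univ T)). Qed.

Lemma closed_finite (T : compactHausdorffType) (A : set T) :
  finite_set A -> closed A.
Proof.
have /accessible_finite_set_closed cT : accessible_space T.
  exact: hausdorff_accessible hausdorff_univ.
exact: cT.
Qed.

Lemma local_bump (R : realType) (T : compactHausdorffType) (O : set T) (x : T) :
  open O -> O x -> exists2 g : T -> R, continuous g &
    [/\ forall z, 0 <= g z <= 1, forall z, g z != 0 -> O z &
        \forall z \near x, g z = 1].
Proof.
move=> oO Ox; have Tn := @compactHausdorff_normal T.
have [|W Wx WO] := Tn [set x] (closed_finite (finite_set1 x)) O.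
  by move=> _ ->; exact: open_nbhs_nbhs.
have [] := @urysohn_ext_itv T R Tn (~` O) (closure W) 0 1.
- exact: open_closedC.
- exact: closed_closure.
- by rewrite -subset0 => z [Oz /WO].
- exact: ltr01.
move=> g [cg g0 g1 gr]; exists g => //; split.
- by move=> z; have := gr (g z) (ex_intro2 _ _ z I erefl); rewrite /= in_itv.
- move=> z gz; apply: contrapT => Oz; move/eqP: gz; apply.
  by apply: g0; exists z.
apply: filterS (Wx x erefl) => z Wz; apply: g1; exists z => //.
exact: subset_closure.
Qed.

(** * Closeness is detected on the boundary *)

Lemma cfun_separates (R : realType) (T : compactHausdorffType) (y z : T) :
  (forall h : Cfun R T, h y = h z) -> y = z.
Proof.
move=> yz; apply: contrapT => ynz.
have [|g [cg gy gz _]] := urysohn_ext_itv (@compactHausdorff_normal T)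
    (closed_finite (finite_set1 y)) (closed_finite (finite_set1 z))
    _ (@ltr01 R).
  by rewrite -subset0 => _ [-> /ynz].
have gy0 : g y = 0 by apply: gy; exists y.
have gz1 : g z = 1 by apply: gz; exists z.
have : (g y)%:C = (g z)%:C :> R[i] := yz (cfun (continuous_real_complex cg)).
by rewrite gy0 gz1 => /complexI/eqP; rewrite eq_sym oner_eq0.
Qed.

Lemma boundary_pullback_close (R : realType) (X Y : S_obj) (F G : S_mor X Y) :
  S_close F G <-> boundary_pullback (R := R) F = boundary_pullback (R := R) G.
Proof.
split=> [FG|FG].
  apply/funext => h; apply: cfunP => x.
  exact: (congr1 (fun u => h (u x)) FG).
apply/funext => x; apply: (@cfun_separates R) => h.
by have /continuousEP/(_ x) := congr1 (fun u => u h) FG.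
Qed.

(** * Controlled neighbourhoods and countable covers *)

(** E z is the slice at z of the neighbourhood of the diagonal. If E z contains
    points y close to a boundary point x, then z is close to x: otherwise z
    would lie in a compact set K avoiding x, and the tube lemma would put K
    times a neighbourhood of x into the open set around the off-diagonal
    boundary pairs, which is disjoint from the neighbourhood of the
    diagonal. *)
Lemma Sp_controlled (X : S_obj) : in_Sp X -> exists E : X -> set X,
  [/\ forall z, open (E z), forall z, inner X z -> E z z &
      forall x (W : set X), ~ inner X x -> nbhs x W ->
        \forall y \near x, forall z, E z y -> W z].
Proof.
move=> [U [V [oU oV UV DU DV]]]; exists (fun z => [set y | U (z, y)]); split.
- move=> z; apply: (@open_comp _ _ (fun y => (z, y)) U) => // y _.
  by apply: cvg_pair; [exact: cvg_cst|exact: cvg_id].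
- by move=> z Xz; apply: DU.
move=> x W xbd Wx.
have /compact_near_coveringP cW : compact (~` W°).
  apply: (@subclosed_compact _ _ [set: X]) => //; last exact: compact_univ.
  by apply: open_closedC; exact: open_interior.
have := cW X (nbhs x) (fun y z => V (z, y)) (nbhs_filter x).
have H z : (~` W°) z -> \forall z' \near z & y \near x, V (z', y).
  move=> Wz; have : V (z, x).
    by apply: DV; split; [move=> /= zx; apply: Wz; rewrite zx|right].
  move=> Vzx; have [[A B] [/= zA xB] AB] : nbhs (z, x) V.
    exact: open_nbhs_nbhs.
  by exists (A, B) => // -[z' y] [/= Az' By]; exact: (AB (z', y)).
move=> /(_ H); apply: filterS => y Vy z Uzy; apply: contrapT => Wz.
have : (U `&` V) (z, y).
  by split => //; apply: Vy => /interior_subset.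
by rewrite UV.
Qed.

(** X is sigma-compact, hence Lindelof. The base point z0 pads the finite
    subcovers of the compact pieces to infinite sequences. *)
Lemma lindelof_seq (X : S_obj) (O : X -> set X) (z0 : X) : inner X z0 ->
    (forall z, inner X z -> nbhs z (O z)) ->
  exists s : nat -> X, (forall n, inner X (s n)) /\
    forall x, inner X x -> exists n, nbhs x (O (s n)).
Proof.
move=> z0X OX; have [K [cK KX]] := S_sigma_compact X.
have /choice[l lP] : forall j, exists l : seq X, {in l, forall z, inner X z} /\
    forall x, K j x -> exists2 z, z \in l & nbhs x (O z).
  move=> j; have /compact_near_coveringP := cK j.
  (* The filter of lists containing any given finite list of centres turns the
     near-covering form of compactness into the extraction of a finite
     subcover. *)
  pose F := filter_from [set: seq X]
    (fun l0 => [set l : seq X | {subset l0 <= l}]).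
  have FF : Filter F.
    apply: filter_from_filter; first by exists [::].
    move=> l1 l2 _ _; exists (l1 ++ l2) => // l ll; split=> z zl; apply: ll.
      by rewrite mem_cat zl.
    by rewrite mem_cat zl orbT.
  pose P (l : seq X) (x : X) :=
    exists z, [/\ z \in l, inner X z & nbhs x (O z)].
  move=> /(_ _ F P FF)[x Kx|l _ lK].
    have Xx : inner X x by rewrite -KX; exists j.
    exists (fun y => nbhs y (O x), [set l : seq X | {subset [:: x] <= l}]).
      split; last by exists [:: x].
      exact: nbhs_interior (OX _ Xx).
    by move=> [y l] [/= yO xl]; exists x; split=> //; apply: xl; rewrite inE.
  exists [seq z <- l | `[< inner X z >]]; split.
    by move=> z; rewrite mem_filter => /andP[/asboolP].
  move=> x /(lK l (fun _ => id))[z [zl zX xz]]; exists z => //.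
  by rewrite mem_filter zl andbT; exact/asboolP.
exists (fun n => if unpickle n is Some (j, i) then nth z0 (l j) i else z0).
split=> [n|x].
  case: unpickle => // -[j i]; have [ij|ij] := ltnP i (size (l j)).
    by apply: (lP j).1; exact: mem_nth.
  by rewrite nth_default.
rewrite -{1}KX => -[j _ /(lP j).2[z zl xz]].
by exists (pickle (j, index z (l j))); rewrite pickleK nth_index.
Qed.

(** * Stick-breaking partitions of unity *)

Section StickBreaking.
Variables (R : realType) (T : Type) (g : nat -> T -> R).
Hypothesis g01 : forall n x, 0 <= g n x <= 1.

(** Take the fraction g n x of what the earlier functions have left over. *)
Definition stick n x := g n x * \prod_(m < n) (1 - g m x).

Lemma stick_ge0 n x : 0 <= stick n x.
Proof.
have /andP[g0 _] := g01 n x; apply: mulr_ge0 => //; apply: prodr_ge0 => m _.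
by rewrite subr_ge0; have /andP[] := g01 m x.
Qed.

Lemma stick_neq0 n x : stick n x != 0 -> g n x != 0.
Proof. by apply: contraNneq => gn; rewrite /stick gn mul0r. Qed.

Lemma sum_stick N x : \sum_(k < N) stick k x = 1 - \prod_(m < N) (1 - g m x).
Proof.
elim: N => [|N IH]; first by rewrite !big_ord0 subrr.
by rewrite !big_ord_recr/= IH /stick mulrBr mulr1 opprB mulrC addrAC addrA.
Qed.

Lemma prod_stick0 m n x : (m < n)%N -> g m x = 1 ->
  \prod_(m < n) (1 - g m x) = 0.
Proof. by move=> mn gm; rewrite (bigD1 (Ordinal mn))//= gm subrr mul0r. Qed.

Lemma stick_eq0 m n x : (m < n)%N -> g m x = 1 -> stick n x = 0.
Proof. by move=> mn gm; rewrite /stick (prod_stick0 mn gm) mulr0. Qed.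

Lemma sum_stick1 m N x : (m < N)%N -> g m x = 1 -> \sum_(k < N) stick k x = 1.
Proof. by move=> mN gm; rewrite sum_stick (prod_stick0 mN gm) subr0. Qed.

Lemma sum_stick_stable (w : nat -> R[i]) m N m' N' x :
  (m < N)%N -> g m x = 1 -> (m' < N')%N -> g m' x = 1 ->
  \sum_(k < N) (stick k x)%:C * w k = \sum_(k < N') (stick k x)%:C * w k.
Proof.
wlog NN' : m N m' N' / (N <= N')%N => [H mN gm m'N' gm'|mN gm _ _].
  have [NN'|/ltnW NN'] := leqP N N'; first exact: (H m N m' N').
  by apply/esym; apply: (H m' N' m N).
rewrite (big_ord_widen _ (fun k => (stick k x)%:C * w k) NN') big_mkcond/=.
apply: eq_bigr => k _; case: ltnP => // Nk.
by rewrite (stick_eq0 (leq_trans mN Nk) gm) mul0r.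
Qed.

End StickBreaking.

(** * A function vanishing at infinity with prescribed lower bounds *)

(** v is the supremum over k of 2^-k u_k, where the Urysohn function u_k
    vanishes on the boundary and is 1 at the finitely many points y_n with
    n < N k. Only finitely many k matter up to a given error, so v is
    continuous. *)
Lemma C0_dominating (R : realType) (Y : compactified) (y : nat -> Y)
    (N : nat -> nat) : (forall n, inner Y (y n)) ->
  exists2 v : Y -> R, continuous v &
    [/\ forall z, ~ inner Y z -> v z = 0, forall z, 0 <= v z &
        forall k n, (n < N k)%N -> 2^-1 ^+ k <= v (y n)].
Proof.
move=> yY.
have /choice[u uP] : forall k, exists u : Y -> R, continuous u /\
    [/\ forall z, ~ inner Y z -> u z = 0, forall z, 0 <= u z <= 1 &
        forall n, (n < N k)%N -> u (y n) = 1].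
  move=> k; have [] := @urysohn_ext_itv Y R (@compactHausdorff_normal Y)
    (~` inner Y) (y @` `I_(N k)) 0 1.
  - exact: boundary_closed.
  - by apply: closed_finite; apply: finite_image; exact: finite_II.
  - by rewrite -subset0 => z [zbd [n _ nz]]; apply: zbd; rewrite -nz.
  - exact: ltr01.
  move=> u [cu u0 u1 ur]; exists u; split=> //; split.
  - by move=> z zbd; apply: u0; exists z.
  - by move=> z; have := ur (u z) (ex_intro2 _ _ z I erefl); rewrite /= in_itv.
  - by move=> n nN; apply: u1; exists (y n) => //; exists n.
pose t k z := 2^-1 ^+ k * u k z; pose v z := sup (range (t ^~ z)).
have w0 k : 0 <= 2^-1 ^+ k :> R by rewrite exprn_ge0.
have w1 k : 2^-1 ^+ k <= 1 :> R by rewrite exprn_ile1// invf_le1// ler1n.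
have t0 k z : 0 <= t k z.
  by have [_ [_ /(_ z)/andP[u0 _] _]] := uP k; exact: mulr_ge0.
have tw k z : t k z <= 2^-1 ^+ k.
  by have [_ [_ /(_ z)/andP[_ u1] _]] := uP k; exact: ler_piMr.
have vt k z : t k z <= v z.
  apply: ub_le_sup; last by exists k.
  by exists 1 => _ [j _ <-]; exact: le_trans (tw _ _) (w1 _).
have v_le z e : (forall k, t k z <= e) -> v z <= e.
  by move=> te; apply: ge_sup; [exists (t 0 z); exists 0|move=> _ [k _ <-]].
exists v; last split.
- move=> z; apply/(@cvgrPdist_le _ R^o) => e e0.
  have [M _ Me] : \forall n \near \oo, 1 / 2 ^+ n < e.
    exact: (near_infty_natSinv_expn_lt (PosNum e0)).
  have tnear : \forall z' \near z, forall k : 'I_M, `|t k z - t k z'| <= e.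
    apply: filter_forall => k; move: e e0 {Me}.
    apply/(@cvgrPdist_le _ R^o); apply: cvgM; first exact: cvg_cst.
    exact: (uP k).1.
  apply: filterS tnear => z' tzz'.
  (* Close to z, the terms with k < M vary by at most e, and the others stay
     below e everywhere. *)
  have tdist k : t k z <= t k z' + e /\ t k z' <= t k z + e.
    have [kM|Mk] := ltnP k M.
      have := tzz' (Ordinal kM); rewrite ler_distlC /= => /andP[h1 h2].
      by rewrite -lerBlDr h1 addrC; move: h2; rewrite addrC.
    have we : 2^-1 ^+ k <= e by have := Me k Mk; rewrite div1r exprVn => /ltW.
    by split; apply: (le_trans (tw _ _)); rewrite (le_trans we)// lerDr.
  rewrite ler_distlC lerBlDr; apply/andP; split.
    apply: v_le => k; apply: le_trans (tdist k).1 _; exact: lerD.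
  apply: v_le => k; apply: le_trans (tdist k).2 _; exact: lerD.
- move=> z zbd; apply/eqP; rewrite eq_le (le_trans (t0 0 z) (vt _ _)) andbT.
  by apply: v_le => k; have [_ [u0 _ _]] := uP k; rewrite /t u0// mulr0.
- by move=> z; apply: le_trans (t0 0 z) (vt _ _).
- move=> k n nN; apply: le_trans (vt k _).
  by have [_ [_ _ u1]] := uP k; rewrite /t u1// mulr1.
Qed.

(** * Bump functions controlled by the compactification *)

(** The input of the averaging construction: [bump_cover] makes the stick
    lengths of the g n a locally finite partition of unity on X, and
    [bump_controlled] keeps the sample points s n close to the support of g n
    near the boundary. *)
Record controlled_bumps (R : realType) (X : S_obj)
    (s : nat -> X) (g : nat -> X -> R) : Prop := ControlledBumps {
  bump_center : forall n, inner X (s n);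
  bump_continuous : forall n, continuous (g n);
  bump_itv : forall n x, 0 <= g n x <= 1;
  bump_cover : forall x, inner X x -> exists n, \forall y \near x, g n y = 1;
  bump_controlled : forall x (W : set X), ~ inner X x -> nbhs x W ->
    \forall y \near x, forall n, g n y != 0 -> W (s n) }.

Lemma controlled_bumps_exist (R : realType) (X : S_obj) (z0 : X) :
  in_Sp X -> inner X z0 ->
  exists (s : nat -> X) (g : nat -> X -> R), controlled_bumps s g.
Proof.
move=> /Sp_controlled[E [oE EE Ectl]] z0X.
have /choice[b bP] : forall z, exists b : X -> R, inner X z ->
    [/\ continuous b, forall y, 0 <= b y <= 1, forall y, b y != 0 -> E z y &
        \forall y \near z, b y = 1].
  move=> z; have [zX|zX] := pselect (inner X z); last by exists (fun=> 0).
  by have [b cb [b01 bE b1]] := local_bump R (oE z) (EE z zX); exists b.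
have [s [sX sO]] := @lindelof_seq X (fun z => [set y | b z y = 1]) z0 z0X
  (fun z zX => let: And4 _ _ _ b1 := bP z zX in b1).
exists s, (fun n => b (s n)); split=> //.
- by move=> n; have [] := bP _ (sX n).
- by move=> n x; have [] := bP _ (sX n).
- move=> x W xbd /(Ectl x W xbd); apply: filterS => y yW n bn.
  by apply: yW; have [_ _ bE _] := bP _ (sX n); exact: bE.
Qed.

Lemma controlled_bumps_compact (R : realType) (X : S_obj) (s : nat -> X)
    (g : nat -> X -> R) (K : set X) : controlled_bumps s g ->
    compact K -> K `<=` inner X ->
  exists N, forall x, K x -> exists2 m, (m < N)%N & g m x = 1.
Proof.
move=> gP /compact_near_coveringP cK KX.
pose P N x := exists2 m, (m < N)%N & g m x = 1.
have [x Kx|N _ NK] := cK nat \oo P _.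
  have [n n1] := bump_cover gP (KX x Kx).
  exists ([set y | g n y = 1], [set N | (n < N)%N]).
    by split=> //; exists n.+1.
  by move=> [y N] [/= gy nN]; exists n.
by exists N; exact: (NK N (leqnn N)).
Qed.

(** * The averaged pullback *)

Section Averaging.
Variables (R : realType) (X Y : S_obj) (F : S_mor X Y).
Variables (s : nat -> X) (g : nat -> X -> R).
Hypothesis gP : controlled_bumps s g.
Local Notation g01 := (bump_itv gP).

Let cover_index (x : X) : {n : nat | inner X x -> \forall y \near x, g n y = 1}.
Proof.
apply: cid; have [xX|xX] := pselect (inner X x); last by exists 0%N.
by have [n n1] := bump_cover gP xX; exists n.
Qed.

(** The sum stops after a chosen index n with g n x = 1; [average_inner] shows
    that its value does not depend on this choice. *)
Definition average (h : Cfun R Y) (x : X) : R[i]^o :=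
  if `[< inner X x >] then
    \sum_(k < (sval (cover_index x)).+1) (stick g k x)%:C * h (F (s k))
  else h (F x).

Lemma average_boundary h x : ~ inner X x -> average h x = h (F x).
Proof. by rewrite /average; case: asboolP. Qed.

Lemma average_inner h m N x : inner X x -> (m < N)%N -> g m x = 1 ->
  average h x = \sum_(k < N) (stick g k x)%:C * h (F (s k)).
Proof.
move=> xX mN gm; rewrite /average asboolT//.
have := svalP (cover_index x) xX => /nbhs_singleton gn.
exact: (@sum_stick_stable R X g (fun k => h (F (s k))) _ _ _ _ _
  (ltnSn _) gn mN gm).
Qed.

Let stickC (n : nat) : Cfun R X :=
  let G m := cfun (continuous_real_complex (@bump_continuous _ _ _ _ gP m)) in
  G n * \prod_(m < n) (1 - G m).

Let stickCE n x : stickC n x = (stick g n x)%:C.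
Proof.
rewrite /stickC cfunME cfun_prodE rmorphM rmorph_prod; congr (_ * _).
by apply: eq_bigr => m _; rewrite cfunBE cfun1E cfunE rmorphB rmorph1.
Qed.

(** Near x one bump g n is constantly 1, so a single finite sum computes the
    average there. *)
Lemma average_continuous_inner h x :
  inner X x -> {for x, continuous (average h)}.
Proof.
move=> xX; have [n n1] := bump_cover gP xX.
pose a : Cfun R X := \sum_(k < n.+1) h (F (s k)) *: stickC k.
have aE y : inner X y -> g n y = 1 -> a y = average h y.
  move=> yX gn; rewrite (average_inner h yX (ltnSn n) gn) cfun_sumE.
  by apply: eq_bigr => k _; rewrite cfunZE stickCE mulrC.
have ax : a x = average h x by apply: aE => //; exact: nbhs_singleton n1.
suff : average h @ x --> average h x by [].
rewrite -ax; apply: cvg_trans (@cfun_continuous _ _ a x).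
apply: near_eq_cvg; near=> y; apply/aE.
  by near: y; apply: open_nbhs_nbhs; split=> //; exact: inner_open.
by near: y.
Unshelve. all: by end_near. Qed.

(** Near a boundary point x all contributing samples s k lie in the set where
    h o F is within e of h (F x), and a convex combination stays within e. *)
Lemma average_continuous_boundary h x :
  ~ inner X x -> {for x, continuous (average h)}.
Proof.
move=> xbd; apply/(@cvgrPdist_le _ R[i]^o) => e e0.
pose W := [set z | `|h (F x) - h (F z)| <= e].
have Wx : nbhs x W.
  have : h \o F @ x --> h (F x).
    apply: (continuous_comp (S_map_continuous F x xbd)).
    exact: cfun_continuous.
  by move=> /(@cvgrPdist_le _ R[i]^o) /(_ e e0).
rewrite average_boundary//.
apply: filterS (filterI Wx (bump_controlled gP xbd Wx)) => y [Wy gW].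
have [yX|yX] := pselect (inner X y); last by rewrite average_boundary.
have [n /nbhs_singleton gn] := bump_cover gP yX.
have s1 : \sum_(k < n.+1) (stick g k y)%:C = 1 :> R[i].
  by rewrite -rmorph_sum (sum_stick1 (ltnSn n) gn) rmorph1.
rewrite (average_inner h yX (ltnSn n) gn) -[h (F x)]mul1r -s1 mulr_suml -sumrB.
apply: le_trans (ler_norm_sum _ _ _) _.
rewrite -[leRHS]mul1r -s1 mulr_suml; apply: ler_sum => k _.
have k0 : 0 <= (stick g k y)%:C :> R[i].
  by rewrite ler0c stick_ge0//; exact: g01.
rewrite -mulrBr normrM ger0_norm//.
have [->|sk] := eqVneq (stick g k y) 0; first by rewrite !mul0r.
by apply: ler_wpM2l => //; apply: gW; exact: stick_neq0 sk.
Qed.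

Lemma average_continuous h : continuous (average h).
Proof.
move=> x; have [xX|xX] := pselect (inner X x).
  exact: average_continuous_inner.
exact: average_continuous_boundary.
Qed.

Definition averaging (h : Cfun R Y) : Cfun R X :=
  cfun (average_continuous (h := h)).

Lemma averaging_finite : finite_averaging averaging.
Proof.
move=> x; have [xX|xbd] := pselect (inner X x).
  have [n /nbhs_singleton gn] := bump_cover gP xX.
  exists n.+1, (fun k => stick g k x), (fun k => F (s k)); split=> [k|h].
    by apply: stick_ge0; exact: g01.
  exact: average_inner gn.
exists 1%N, (fun=> 1), (fun=> F x); split=> [_|h]; first exact: ler01.
by rewrite cfunE average_boundary// big_ord1 rmorph1 mul1r.
Qed.

Lemma averaging1 : averaging 1 = 1.
Proof.
apply: cfunP => x; rewrite cfun1E cfunE.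
have [xX|xbd] := pselect (inner X x); last by rewrite average_boundary.
have [n /nbhs_singleton gn] := bump_cover gP xX.
rewrite (average_inner 1 xX (ltnSn n) gn).
transitivity (\sum_(k < n.+1) stick g k x)%:C.
  by rewrite rmorph_sum; apply: eq_bigr => k _; rewrite cfun1E mulr1.
by rewrite (sum_stick1 (ltnSn n) gn).
Qed.

(** If 2^-k <= |b x| with k least, then only samples s n with n < N k
    contribute to the average at x, and a is at least |b x| at each F (s n). So
    |h (F (s n))| |b x| is at most the norm of h a for each of them. *)
Lemma averaging_dominated (b : Cfun R X) : C0 b ->
  exists2 a : Cfun R Y, C0 a & forall h x, `|averaging h x * b x| <= `|h * a|.
Proof.
move=> [b0 bK].
have w0 k : 0 < 2^-1 ^+ k :> R by rewrite exprn_gt0.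
have /choice[N NP] : forall k, exists N, forall x, inner X x ->
    (2^-1 ^+ k)%:C <= `|b x| -> exists2 m, (m < N)%N & g m x = 1.
  move=> k; have [K [cK KX Kb]] := bK _ (w0 k).
  have [N NK] := controlled_bumps_compact gP cK KX.
  exists N => x xX bx; apply: NK; apply: contrapT => /(Kb x xX).
  by move=> /(le_lt_trans bx); rewrite ltxx.
have sY n : inner Y (F (s n)) by apply: S_map_inner; exact: bump_center gP n.
have [v cv [v0 v_ge0 vN]] := @C0_dominating R Y (fun n => F (s n)) N sY.
pose B := complex.Re (sup_norm b).
have BE : B%:C = sup_norm b by rewrite RRe_real ?ger0_real ?sup_norm_ge0.
have B0 : 0 <= B by rewrite -ler0c BE sup_norm_ge0.
pose a := (2 + B)%:C *: cfun (continuous_real_complex cv).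
have aE z : a z = ((2 + B) * v z)%:C by rewrite cfunZE cfunE rmorphM.
(* The factor 2 pays for the gap between |b x| and 2^-k when 0 < k, and the
   summand B, a bound of |b|, covers the case k = 0. *)
exists a; first by apply/C0P => z zbd; rewrite aE v0// mulr0.
move=> h x; have [bx0|bx0] := eqVneq (b x) 0; first by rewrite bx0 mulr0 normr0.
have xX : inner X x by apply: contrapT => /b0/eqP; rewrite (negbTE bx0).
have br : `|b x| = (complex.Re `|b x|)%:C by rewrite normc_Re.
have r0 : 0 < complex.Re `|b x| by rewrite -(@ltcR R) -br normr_gt0.
have bB : complex.Re `|b x| <= B.
  by rewrite -lecR normc_Re BE; exact: sup_norm_ge.
have ex : exists k, 2^-1 ^+ k <= complex.Re `|b x|.
  have [M _ /(_ M (leqnn M))] := near_infty_natSinv_expn_lt (PosNum r0).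
  by rewrite /= div1r -exprVn => /ltW; exists M.
have [k bk kmin] := ex_minnP ex.
have dom n : (n < N k)%N -> `|b x| <= a (F (s n)).
  move=> nN; rewrite br aE lecR.
  apply: le_trans (_ : (2 + B) * 2^-1 ^+ k <= _); last first.
    by apply: ler_wpM2l; [exact: addr_ge0|exact: vN].
  case: k bk kmin nN => [|k] bk kmin nN.
    by rewrite expr0 mulr1 (le_trans bB)// lerDr.
  have : complex.Re `|b x| < 2^-1 ^+ k.
    by rewrite ltNge; apply/negP => /kmin; rewrite ltnn.
  move=> /ltW/le_trans; apply; rewrite exprS mulrA mulrDl mulfV ?pnatr_eq0//.
  by apply: ler_peMl; [exact: ltW|rewrite lerDl mulr_ge0].
have [|m mN gm] := NP k x xX; first by rewrite br lecR.
rewrite cfunE (average_inner h xX mN gm) mulr_suml.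
apply: le_trans (ler_norm_sum _ _ _) _.
apply: (@le_trans _ _ (\sum_(i < N k) (stick g i x)%:C * `|h * a|)).
  apply: ler_sum => i _.
  have i0 : 0 <= (stick g i x)%:C :> R[i].
    by rewrite ler0c stick_ge0//; exact: g01.
  rewrite !normrM ger0_norm// -mulrA; apply: ler_wpM2l => //.
  apply: le_trans (sup_norm_ge (h * a) (F (s i))); rewrite cfunME normrM.
  apply: ler_wpM2l => //; apply: le_trans (dom i (ltn_ord i)) _.
  by rewrite ger0_norm// aE ler0c mulr_ge0// addr_ge0.
by rewrite -mulr_suml -rmorph_sum (sum_stick1 mN gm) mul1r.
Qed.

End Averaging.

Lemma inner_nonempty (X : compactified) (x : X) : exists y, inner X y.
Proof.
by have [y [_ Xy]] := inner_dense (ex_intro _ x I) openT; exists y.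
Qed.

Theorem proposition6p6 (R : realType) (X Y : S_obj)
    (SpX : in_Sp X) (SpY : in_Sp Y) :
  (forall F : S_mor X Y,
     exists phi : nc_coarse_map (C0_coarse R Y) (C0_coarse R X),
       corresponds phi F) /\
  (forall (F1 F2 : S_mor X Y)
          (phi1 phi2 : nc_coarse_map (C0_coarse R Y) (C0_coarse R X)),
     corresponds phi1 F1 -> corresponds phi2 F2 ->
     (S_close F1 F2 <-> nc_close phi1 phi2)).
Proof.
split=> [F|F1 F2 phi1 phi2 c1 c2]; last first.
  by rewrite /nc_close c1 c2; exact: boundary_pullback_close.
have [[z0 z0X]|X0] := pselect (exists x, inner X x).
  have [s [g gP]] := controlled_bumps_exist R SpX z0X.
  apply: (@coarse_map_exists R X Y F (averaging F gP)).
  - exact: averaging_finite.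
  - exact: averaging1.
  - exact: average_boundary.
  - exact: averaging_dominated.
(* There are no sample points to choose if X is empty, but then C(X) = 0. *)
have Xempty : X -> False by move=> /inner_nonempty.
apply: (@coarse_map_exists R X Y F (fun=> 0)).
- by move=> x; case: (Xempty x).
- by apply: cfunP => x; case: (Xempty x).
- by move=> h x; case: (Xempty x).
- move=> b _; exists 0; first by apply/C0P.
  by move=> h x; case: (Xempty x).
Qed.
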